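(* There exist an integer $p$ with $2\le p\le 5$ and a continuous family $(Q_t)_{t\in I}$ ($I\subset\mathbb{R}$ an interval of positive length) of pairwise non-congruent $5$-simplices in $\mathbb{R}^{p,5-p}$ such that, for each of the twenty 2-faces, the area of that 2-face of $Q_t$ is independent of $t$, and, for every $t\in I$, every 2-face of $Q_t$ is contained in a Euclidean plane, but the $5$-volume of $Q_t$ is not constant in $t$.
   Context: For $0\le p\le n$, $\mathbb{R}^{p,n-p}$ is the $n$-dimensional real vector space with bilinear product $x\cdot y=x_1y_1+\cdots+x_py_p-x_{p+1}y_{p+1}-\cdots-x_ny_n$. An $n$-simplex in $\mathbb{R}^{p,n-p}$ is the convex hull of $n+1$ affinely independent (labeled) points; its $k$-faces are the $k$-simplices spanned by $k+1$ of its vertices. For a $k$-simplex $G$, choose a vertex as base point and let $u_1,\dots,u_k$ be the vectors from it to the other vertices; the $k$-volume of $G$ is $V_k(G)=|\det(u_i\cdot u_j)_{1\le i,j\le k}|^{1/2}/k!$ (independent of the base point). For $k=2$ it is called the area. A continuous family of $n$-simplices is a family indexed by a real interval whose vertices depend continuously on the parameter (faces at different parameters correspond via the vertex labels). Two simplices are congruent if an isometry of $\mathbb{R}^{p,n-p}$ maps one onto the other. A (2-dimensional affine) plane is a Euclidean plane if the restriction of the bilinear product to its direction space is positive definite. *)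

(* Defs.v *)
From mathcomp Require Import all_boot all_order all_algebra.
From mathcomp Require Import boolp classical_sets functions reals topology normedtype.

Set Implicit Arguments.
Unset Strict Implicit.
Unset Printing Implicit Defensive.

Import Order.TTheory GRing.Theory Num.Theory.
Import numFieldNormedType.Exports.

Local Open Scope classical_set_scope.
Local Open Scope ring_scope.

(* The product of R^{p,n-p}; coordinates are numbered from 0, so the positive
   ones are 0, ..., p-1. *)
Definition dotp (R : realType) (n p : nat) (x y : 'rV[R]_n) : R :=
  \sum_(i < n | (i < p)%N) x 0 i * y 0 i
  - \sum_(i < n | (p <= i)%N) x 0 i * y 0 i.

Definition affinely_independent (R : realType) (n k : nat)
    (P : 'I_k.+1 -> 'rV[R]_n) : Prop :=
  forall c : 'I_k.+1 -> R,
    \sum_i c i = 0 -> \sum_i c i *: P i = 0 -> forall i, c i = 0.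

Definition convex_hull (R : realType) (n k : nat)
    (P : 'I_k.+1 -> 'rV[R]_n) : set 'rV[R]_n :=
  [set x | exists c : 'I_k.+1 -> R,
     [/\ forall i, 0 <= c i, \sum_i c i = 1 & x = \sum_i c i *: P i]].

(* The k-volume of the simplex with vertices P 0, ..., P k, computed from the
   base point P 0. *)
Definition kvolume (R : realType) (n p k : nat)
    (P : 'I_k.+1 -> 'rV[R]_n) : R :=
  let u (i : 'I_k) := P (lift ord0 i) - P ord0 in
  Num.sqrt `|\det (\matrix_(i < k, j < k) dotp p (u i) (u j))| / (k`!)%:R.

Definition area (R : realType) (n p : nat) (P : 'I_3 -> 'rV[R]_n) : R :=
  @kvolume R n p 2 P.

(* A bijection preserving the (possibly negative) squared distance; since dotp
   is nondegenerate, such a map is automatically affine. *)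
Definition isometry (R : realType) (n p : nat)
    (f : 'rV[R]_n -> 'rV[R]_n) : Prop :=
  bijective f /\
  forall x y, dotp p (f x - f y) (f x - f y) = dotp p (x - y) (x - y).

(* Congruence of the simplices as point sets: the labels of the vertices need
   not be respected. *)
Definition congruent (R : realType) (n p k : nat)
    (P Q : 'I_k.+1 -> 'rV[R]_n) : Prop :=
  exists f : 'rV[R]_n -> 'rV[R]_n,
    isometry p f /\ f @` convex_hull P = convex_hull Q.

Definition euclidean_plane (R : realType) (n p : nat)
    (E : set 'rV[R]_n) : Prop :=
  exists (a : 'rV[R]_n) (D : {vspace 'rV[R]_n}),
    [/\ \dim D = 2%N,
        E = [set x | x - a \in D] &
        forall v, v \in D -> v != 0 -> 0 < dotp p v v].

(* Main.v *)
From mathcomp Require Import all_boot all_order all_algebra perm ring lra.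
From mathcomp Require Import boolp classical_sets functions reals topology.
From mathcomp Require Import normedtype realfun.
Require Import Defs.

Set Implicit Arguments.
Unset Strict Implicit.
Unset Printing Implicit Defensive.

Import Order.TTheory GRing.Theory Num.Theory.
Import numFieldNormedType.Exports.

Local Open Scope classical_set_scope.
Local Open Scope ring_scope.

(** Sixteen times the squared area of a triangle is Heron's quadratic form
[[heron a b c = 2 (a b + b c + c a) - (a^2 + b^2 + c^2)]]
in the squared side lengths.  This form is Lorentzian, and it vanishes on the
squares of three numbers one of which is the sum of the two others.  Hence, if
[u] and [v] are two distances on the vertex labels for which every triangle is
degenerate, the squared lengths [t u^2 + v^2 / t] give every triangle the value
[2 B (u^2, v^2)] of the form, [B] being its polarization: all areas are
constant in [t].  This value is positive, so that the triangles are Euclidean,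
as soon as [u^2] and [v^2] are non-proportional on each triangle, since
non-proportional null vectors in the same closed half-cone have a positive
product.

If [u] and [v] both were distances between points of a line, the simplex would
be planar.  The other source of degenerate triangles is Menger's pseudo-linear
quadruple: the four vertices of an [a] by [b] rectangle with the taxicab
distance [a e1 + b e2], where [e1] and [e2] in {0,1} say whether two vertices differ in each direction.
As [2 e1 e2 = e1 + e2 - e3] with [e3] the exclusive or of [e1] and [e2],
[[(a e1 + b e2)^2 = a (a + b) e1 + b (a + b) e2 - a b e3,]]
so this quadruple lies on the vertices of a box in R^{2,1}.  The six labels are
sent to the vertices of a 1 by 1 rectangle (for [u]) and of a 1 by 2 rectangle
(for [v]); each map identifies two pairs of labels, and these pairs are disjoint
for the two maps.  Both maps are chosen with the same bit [e3], so that the two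
negative coordinates merge into a single one, with weight [t + 2 / t], and
[t u^2 + v^2 / t] is realized in R^{4,1} with the weights
[2 t, 2 t, 3 / t, 6 / t, t + 2 / t] on the squared coordinates
([label_bit], [weight], [sqdist_simplex_at]).

The squared 5-volume is the product [72 (t + 2 / t)] of the weights up to a
nonzero constant, so the volume is injective in [t] for [t >= 2].  This also
separates the congruence classes, because the volume is an invariant of the
convex hull ([congruent_kvolume]): it is the largest volume spanned by [n + 1]
points of the hull, a stochastic matrix having determinant at most 1 in absolute
value ([stochastic_det_le1]), and volumes depend only on squared distances
([dotp_polarization]). *)

(** * Squared distances and Gram determinants *)

Definition msign (R : realType) (p i : nat) : R := if (i < p)%N then 1 else -1.
Arguments msign : clear implicits.

Lemma dotpE (R : realType) (n p : nat) (x y : 'rV[R]_n) :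
  dotp p x y = \sum_(i < n) msign R p i * (x 0 i * y 0 i).
Proof.
rewrite /dotp [RHS](bigID (fun i : 'I_n => (i < p)%N)) /= -sumrN.
congr (_ + _); first by apply: eq_bigr => i ip; rewrite /msign ip mul1r.
apply: eq_big => [i|i]; first by rewrite leqNgt.
by rewrite leqNgt /msign => /negbTE ->; rewrite mulN1r.
Qed.

Definition sqdist (R : realType) (n p : nat) (x y : 'rV[R]_n) : R :=
  dotp p (x - y) (x - y).

Lemma dotp_polarization (R : realType) (n p : nat) (x y z : 'rV[R]_n) :
  dotp p (x - z) (y - z) = (sqdist p x z + sqdist p y z - sqdist p x y) / 2.
Proof.
rewrite /sqdist !dotpE -sumrN -!big_split mulr_suml; apply: eq_bigr => i _ /=.
by rewrite !mxE; field.
Qed.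

Definition edges (R : realType) (n k : nat) (P : 'I_k.+1 -> 'rV[R]_n) :
    'M[R]_(k, n) :=
  \matrix_(i < k) (P (lift ord0 i) - P ord0).

(** The matrix of the bilinear product is diagonal with entries 1 and -1, hence
contributes only a sign to the determinant. *)
Lemma det_gram_edges (R : realType) (n p : nat) (P : 'I_n.+1 -> 'rV[R]_n) :
  `|\det (\matrix_(i < n, j < n) dotp p (P (lift ord0 i) - P ord0)
                                        (P (lift ord0 j) - P ord0))|
  = \det (edges P) ^+ 2.
Proof.
have -> : (\matrix_(i < n, j < n) dotp p (P (lift ord0 i) - P ord0)
                                         (P (lift ord0 j) - P ord0))
    = edges P *m diag_mx (\row_(k < n) msign R p k) *m (edges P)^T.
  apply/matrixP => i j; rewrite [RHS]mxE mxE dotpE; apply: eq_bigr => k _.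
  by rewrite mul_mx_diag !mxE; ring.
rewrite !det_mulmx det_tr det_diag !normrM normr_prod big1 => [|i _].
  by rewrite mulr1 -normrM -expr2 normrX real_normK ?num_real.
by rewrite mxE /msign; case: ifP; rewrite ?normrN normr1.
Qed.

Lemma kvolume_edges (R : realType) (n p : nat) (P : 'I_n.+1 -> 'rV[R]_n) :
  kvolume p P = `|\det (edges P)| / (n`!)%:R.
Proof. by rewrite /kvolume /= det_gram_edges sqrtr_sqr. Qed.

(** A linear relation between the edges at the base point is an affine relation
between the vertices, the base point taking the opposite of the other
coefficients. *)
Lemma affinely_independent_det (R : realType) (n : nat)
    (P : 'I_n.+1 -> 'rV[R]_n) :
  affinely_independent P -> \det (edges P) != 0.
Proof.
move=> indP; apply/negP => /det0P[v /rV0Pn[j /eqP vj] vP]; apply: vj.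
pose c i := if unlift ord0 i is Some k then v 0 k else - \sum_k v 0 k.
have c0 : c ord0 = - \sum_k v 0 k by rewrite /c unlift_none.
have cS k : c (lift ord0 k) = v 0 k by rewrite /c liftK.
rewrite -cS; apply: indP.
  by rewrite big_ord_recl (eq_bigr _ (fun i _ => cS i)) c0 addNr.
rewrite big_ord_recl; under eq_bigr do rewrite cS; rewrite c0.
rewrite -[RHS]vP mulmx_sum_row scaleNr scaler_suml -sumrN -big_split.
by apply: eq_bigr => i _ /=; rewrite rowK scalerBr addrC.
Qed.

(** Homogeneous coordinates turn barycentric combinations of the vertices into
left multiplication by the matrix of the coefficients. *)
Definition homogeneous (R : realType) (n : nat) (P : 'I_n.+1 -> 'rV[R]_n) :
    'M[R]_(1 + n) :=
  \matrix_i row_mx 1%:M (P i).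

Lemma homogeneousE (R : realType) (n : nat) (P : 'I_n.+1 -> 'rV[R]_n) i j :
  homogeneous P i j = row_mx 1%:M (P i) 0 j.
Proof. by rewrite mxE. Qed.

(** Subtracting the row of the base point from the other rows. *)
Lemma det_homogeneous (R : realType) (n : nat) (P : 'I_n.+1 -> 'rV[R]_n) :
  \det (homogeneous P) = \det (edges P).
Proof.
pose S : 'M[R]_(1 + n) := block_mx 1%:M 0 (const_mx (-1)) 1%:M.
have -> : \det (edges P) = \det (S *m homogeneous P).
  have -> : homogeneous P =
      block_mx 1%:M (P ord0) (const_mx 1) (\matrix_i P (lift ord0 i)).
    have l0 : lshift n (0 : 'I_1) = ord0 by apply: val_inj.
    have rS (i : 'I_n) : rshift 1 i = lift ord0 i by apply: val_inj.
    apply/matrixP => i j; rewrite -[i]fintype.splitK -[j]fintype.splitK.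
    case: (fintype.split i) => i'; case: (fintype.split j) => j' /=;
      rewrite ?(block_mxEul, block_mxEur, block_mxEdl, block_mxEdr);
      rewrite homogeneousE ?row_mxEl ?row_mxEr ?(ord1 i') ?(ord1 j') ?l0 ?rS;
      by rewrite ?mxE.
  rewrite /S mulmx_block !mul1mx !mul0mx !addr0 mulmx1.
  have -> : const_mx (-1) + const_mx 1 = 0 :> 'cV[R]_n.
    by apply/matrixP => i j; rewrite !mxE addNr.
  rewrite det_ublock det1 mul1r; congr (\det _).
  by apply/matrixP => i j; rewrite !mxE big_ord1 !mxE mulN1r addrC.
by rewrite det_mulmx /S det_lblock !det1 !mul1r.
Qed.

(** The sum of the Leibniz terms over permutations is at most the sum over all
maps, which is the product of the row sums. *)
Lemma stochastic_det_le1 (R : realType) (n : nat) (C : 'M[R]_n) :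
  (forall i j, 0 <= C i j) -> (forall i, \sum_j C i j = 1) -> `|\det C| <= 1.
Proof.
move=> C0 C1; apply: (le_trans (ler_norm_sum _ _ _)).
have sum1 : \sum_(f : {ffun 'I_n -> 'I_n}) \prod_i C i (f i) = 1.
  by rewrite -(bigA_distr_bigA (fun i j => C i j)) big1.
rewrite -[leRHS]sum1.
rewrite (bigID (fun f : {ffun _ -> _} => injectiveb f)) /=.
rewrite -[X in X <= _]addr0 lerD //; last first.
  by apply: sumr_ge0 => f _; apply: prodr_ge0.
rewrite [leRHS](reindex (@pval _)) /=; last first.
  pose in_Sn := insubd (1%g : 'S_n).
  by exists in_Sn => /= f Uf; first apply: val_inj; apply: insubdK.
rewrite le_eqVlt; apply/orP; left; apply/eqP.
apply: eq_big => [s|s _]; first by rewrite (valP s).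
rewrite normrM normr_sign mul1r ger0_norm ?prodr_ge0 //.
by apply: eq_bigr => i _; rewrite pvalE.
Qed.

Lemma det_edges_hull (R : realType) (n : nat) (P Y : 'I_n.+1 -> 'rV[R]_n) :
  (forall i, convex_hull P (Y i)) -> `|\det (edges Y)| <= `|\det (edges P)|.
Proof.
move=> /choice[c hc]; rewrite -!det_homogeneous.
pose C : 'M[R]_(1 + n) := \matrix_(i, j) c i j.
have -> : homogeneous Y = C *m homogeneous P.
  apply/row_matrixP => i; rewrite row_mul rowK mulmx_sum_row.
  have [_ c1 ->] := hc i.
  under [in RHS]eq_bigr do rewrite rowK !mxE scale_row_mx.
  apply/rowP => j; rewrite summxE -[j]fintype.splitK.
  case: (fintype.split j) => j' /=.
    rewrite row_mxEl; under eq_bigr do rewrite row_mxEl !mxE.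
    by rewrite -mulr_suml c1 mul1r mxE.
  rewrite row_mxEr summxE.
  by apply: eq_bigr => k _; rewrite row_mxEr.
rewrite det_mulmx normrM ler_piMl //.
apply: stochastic_det_le1 => i; first by move=> j; rewrite mxE; case: (hc i).
by under eq_bigr do rewrite mxE; case: (hc i).
Qed.

Lemma isometry_det_edges (R : realType) (n p : nat) (f : 'rV[R]_n -> 'rV[R]_n)
    (P : 'I_n.+1 -> 'rV[R]_n) :
  Defs.isometry p f -> `|\det (edges (f \o P))| = `|\det (edges P)|.
Proof.
move=> [_ fiso]; apply/eqP; rewrite -(@eqrXn2 _ 2) ?normr_ge0 // !real_normK ?num_real //.
rewrite -!(det_gram_edges p); apply/eqP; congr (`|\det _|).
by apply/matrixP => i j; rewrite !mxE !dotp_polarization /sqdist /= !fiso.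
Qed.

Lemma hull_vertex (R : realType) (n k : nat) (P : 'I_k.+1 -> 'rV[R]_n) i :
  convex_hull P (P i).
Proof.
exists (fun j => (j == i)%:R); split=> [j||]; first exact: ler0n.
  by rewrite (bigD1 i) //= eqxx big1 ?addr0 // => j /negbTE->.
rewrite (bigD1 i) //= eqxx scale1r big1 ?addr0 // => j /negbTE->.
by rewrite scale0r.
Qed.

(** Congruence does not respect labels, nor is the map assumed to be affine; so
the volume is recognized as the maximal volume spanned by points of the hull,
and each simplex is compared with the image, or a preimage, of the vertices of
the other. *)
Lemma congruent_kvolume (R : realType) (n p : nat)
    (P Q : 'I_n.+1 -> 'rV[R]_n) :
  congruent p P Q -> kvolume p P = kvolume p Q.
Proof.
move=> [f [fiso fPQ]]; rewrite !kvolume_edges; congr (_ / _); apply/le_anti/andP; split.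
  rewrite -(isometry_det_edges P fiso); apply: det_edges_hull => i.
  by rewrite -fPQ; exists (P i) => //; exact: hull_vertex.
have /choice[g hg] : forall i, exists x, convex_hull P x /\ f x = Q i.
  by move=> i; have := hull_vertex Q i; rewrite -fPQ => -[x Px fx]; exists x.
have -> : Q = f \o g by apply/funext => i; case: (hg i).
by rewrite (isometry_det_edges g fiso); apply: det_edges_hull => i; case: (hg i).
Qed.

(** * Areas of triangles *)

Definition heron (R : realType) (a b c : R) : R :=
  2 * (a * b + b * c + c * a) - (a ^+ 2 + b ^+ 2 + c ^+ 2).

Definition heron_polar (R : realType) (a b c a' b' c' : R) : R :=
  a * (b' + c' - a') + b * (a' + c' - b') + c * (a' + b' - c').

Lemma heron_lin2 (R : realType) (t a b c a' b' c' : R) : t != 0 ->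
  heron (t * a + t^-1 * a') (t * b + t^-1 * b') (t * c + t^-1 * c')
  = t ^+ 2 * heron a b c + t ^- 2 * heron a' b' c'
    + 2 * heron_polar a b c a' b' c'.
Proof. by move=> t0; rewrite /heron /heron_polar; field. Qed.

(** Heron's factorization
[heron (a^2) (b^2) (c^2) = (a + b + c) (a + b - c) (b + c - a) (c + a - b)]. *)
Lemma heron_degenerate (R : realType) (a b c : nat) :
  [|| a + b == c, b + c == a | c + a == b]%N ->
  heron (a ^ 2)%:R (b ^ 2)%:R (c ^ 2)%:R = 0 :> R.
Proof.
by rewrite /heron !natrX => /or3P[] /eqP <-; rewrite natrD; ring.
Qed.

Lemma det_mx2 (R : realType) (A : 'M[R]_2) :
  \det A = A 0 0 * A 1 1 - A 0 1 * A 1 0.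
Proof.
rewrite (expand_det_row _ 0) !big_ord_recl big_ord0 /cofactor !det_mx11 !mxE /=.
have -> : lift 0 0 = 1 :> 'I_2 by apply: val_inj.
have -> : lift 1 0 = 0 :> 'I_2 by apply: val_inj.
by rewrite /= addr0 expr0 mul1r expr1 mulN1r mulrN.
Qed.

Lemma sqdistC (R : realType) (n p : nat) (x y : 'rV[R]_n) :
  sqdist p x y = sqdist p y x.
Proof.
rewrite /sqdist !dotpE; apply: eq_bigr => i _.
by rewrite -opprB !mxE mulrNN.
Qed.

Lemma gram2_heron (R : realType) (n p : nat) (P : 'I_3 -> 'rV[R]_n)
    (x := P ord0) (y := P (lift ord0 0)) (z := P (lift ord0 1)) :
  dotp p (y - x) (y - x) * dotp p (z - x) (z - x) - dotp p (y - x) (z - x) ^+ 2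
  = heron (sqdist p x y) (sqdist p x z) (sqdist p y z) / 4.
Proof.
by rewrite (dotp_polarization p y z x) /heron !(sqdistC p x) -!/(sqdist _ _ _); field.
Qed.

Lemma dotpC (R : realType) (n p : nat) (x y : 'rV[R]_n) :
  dotp p x y = dotp p y x.
Proof. by rewrite !dotpE; apply: eq_bigr => i _; rewrite [x 0 i * _]mulrC. Qed.

Lemma area_heron (R : realType) (n p : nat) (P : 'I_3 -> 'rV[R]_n)
    (x := P ord0) (y := P (lift ord0 0)) (z := P (lift ord0 1)) :
  area p P = Num.sqrt `|heron (sqdist p x y) (sqdist p x z) (sqdist p y z) / 4|
             / 2.
Proof.
rewrite /area /kvolume /= -gram2_heron det_mx2 !mxE expr2.
by rewrite (dotpC p (P (lift ord0 1) - _) (P (lift ord0 0) - _)).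
Qed.

Lemma dotp_comb (R : realType) (n p : nat) (a b : R) (u v : 'rV[R]_n) :
  dotp p (a *: u + b *: v) (a *: u + b *: v)
  = a ^+ 2 * dotp p u u + 2 * a * b * dotp p u v + b ^+ 2 * dotp p v v.
Proof.
rewrite !dotpE !mulr_sumr -!big_split; apply: eq_bigr => i _ /=.
by rewrite !mxE; ring.
Qed.

(** A positive squared edge and a positive Gram determinant make the product
positive definite on the directions of the triangle, which also forces the two
edges to be independent. *)
Lemma euclidean_triangle (R : realType) (n p : nat) (P : 'I_3 -> 'rV[R]_n)
    (x := P ord0) (y := P (lift ord0 0)) (z := P (lift ord0 1)) :
  0 < sqdist p x y ->
  0 < heron (sqdist p x y) (sqdist p x z) (sqdist p y z) ->
  exists E : set 'rV[R]_n, euclidean_plane p E /\ convex_hull P `<=` E.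
Proof.
set u := y - x; set v := z - x => xy_gt0 h_gt0.
have uu_gt0 : 0 < dotp p u u by rewrite sqdistC in xy_gt0.
have gram_gt0 : 0 < dotp p u u * dotp p v v - dotp p u v ^+ 2.
  by rewrite gram2_heron divr_gt0.
have form_gt0 a b : (a != 0) || (b != 0) ->
    0 < dotp p (a *: u + b *: v) (a *: u + b *: v).
  (* complete the square after multiplying by the positive [dotp p u u] *)
  move=> ab0; rewrite dotp_comb -(pmulr_rgt0 _ uu_gt0).
  have -> : dotp p u u * (a ^+ 2 * dotp p u u + 2 * a * b * dotp p u v
                          + b ^+ 2 * dotp p v v)
      = (a * dotp p u u + b * dotp p u v) ^+ 2
        + b ^+ 2 * (dotp p u u * dotp p v v - dotp p u v ^+ 2) by ring.
  have [b0|b0] := eqVneq b 0.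
    rewrite b0 eqxx orbF in ab0 *.
    by rewrite mul0r addr0 expr0n mul0r addr0 exprn_even_gt0 // mulf_neq0 // gt_eqF.
  by rewrite ltr_wpDl ?sqr_ge0 // mulr_gt0 // exprn_even_gt0.
have dotp0 : dotp p (0 : 'rV[R]_n) 0 = 0.
  by rewrite dotpE big1 // => i _; rewrite mxE mul0r mulr0.
have memD w : w \in <<[:: u; v]>>%VS -> exists a b, w = a *: u + b *: v.
  rewrite span_cons span_seq1 => /memv_addP[u' /vlineP[a ->]] [v' /vlineP[b ->] ->].
  by exists a, b.
exists [set w | w - x \in <<[:: u; v]>>%VS]; split.
  exists x, <<[:: u; v]>>%VS; split=> //.
    apply/eqP; rewrite -/(free [:: u; v]).
    apply/(@freeP _ _ 2 [tuple u; v]) => k; rewrite !big_ord_recl big_ord0 addr0 /=.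
    move=> k0 i; apply/eqP; apply: contraT => ki.
    have := form_gt0 (k ord0) (k (lift ord0 ord0)).
    rewrite k0 dotp0 ltxx => -> //.
    by case: i ki => -[|[|//]] hi ki; apply/orP; [left|right];
      apply: contraNneq ki => <-; apply/eqP; congr k; apply: val_inj.
  move=> w /memD[a [b ->]] w0; apply: form_gt0.
  by apply: contraNT w0; rewrite negb_or !negbK => /andP[/eqP-> /eqP->];
    rewrite !scale0r addr0.
move=> _ [c [_ c1 ->]] /=.
have -> : \sum_i c i *: P i - x = c (lift ord0 0) *: u + c (lift ord0 1) *: v.
  rewrite -[x in LHS]scale1r -c1 scaler_suml -sumrB big_ord_recl subrr add0r.
  rewrite !big_ord_recl big_ord0 addr0 -!scalerBr.
  by congr (_ *: (P _ - x) + c _ *: (P _ - x)); apply: val_inj.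
by apply: rpredD; apply: rpredZ; apply: memv_span; rewrite !inE eqxx ?orbT.
Qed.

(** * The family of simplices *)

(** The bits 0 and 1 place a label on the square defining [udist], the bits 2 and
3 on the rectangle defining [vdist].  Every half {0,1,2}, {3,4,5} of the labels
goes to two opposite vertices of each rectangle: on it [udist] identifies the
first two labels and [vdist] the last two.  The bit 4 is the exclusive or of the
two bits of either rectangle. *)
Definition label_bit (k i : nat) : bool :=
  let r := (i %% 3 == 2)%N in let s := (i %% 3 != 0)%N in let h := (2 < i)%N in
  nth false [:: r; r (+) h; s; s (+) h; h] k.

Definition udist (i j : nat) : nat :=
  (label_bit 0 i (+) label_bit 0 j) + (label_bit 1 i (+) label_bit 1 j).

Definition vdist (i j : nat) : nat :=
  (label_bit 2 i (+) label_bit 2 j) + 2 * (label_bit 3 i (+) label_bit 3 j).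

Ltac case_label i := case: i => -[|[|[|[|[|[|//]]]]]] ?.

(** Among three vertices of a rectangle, one is always between the two others
for the taxicab distance. *)
Lemma udist_degenerate (i j k : 'I_6) :
  [|| udist i j + udist i k == udist j k, udist i k + udist j k == udist i j
    | udist j k + udist i j == udist i k]%N.
Proof. by case_label i; case_label j; case_label k. Qed.

Lemma vdist_degenerate (i j k : 'I_6) :
  [|| vdist i j + vdist i k == vdist j k, vdist i k + vdist j k == vdist i j
    | vdist j k + vdist i j == vdist i k]%N.
Proof. by case_label i; case_label j; case_label k. Qed.

(** The pairs of labels identified by the two rectangles are disjoint, which keeps
all edges of the simplices spacelike. *)
Lemma dist_gt0 (i j : 'I_6) : i != j -> (0 < udist i j + vdist i j)%N.
Proof.
by case_label i; case_label j.
Qed.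

(** Positivity of the polarized form, with the negative terms moved to the left
so as to be a computation in the natural numbers. *)
Lemma uv_nonproportional (i j k : 'I_6) : i != j -> j != k -> i != k ->
  let a := (udist i j ^ 2)%N in let a' := (vdist i j ^ 2)%N in
  let b := (udist i k ^ 2)%N in let b' := (vdist i k ^ 2)%N in
  let c := (udist j k ^ 2)%N in let c' := (vdist j k ^ 2)%N in
  (a * a' + b * b' + c * c' < a * (b' + c') + b * (a' + c') + c * (a' + b'))%N.
Proof.
by case_label i; case_label j; case_label k.
Qed.

Lemma uv_polar_gt0 (R : realType) (i j k : 'I_6) : i != j -> j != k -> i != k ->
  0 < heron_polar (udist i j ^ 2)%:R (udist i k ^ 2)%:R (udist j k ^ 2)%:R
        (vdist i j ^ 2)%:R (vdist i k ^ 2)%:R (vdist j k ^ 2)%:R :> R.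
Proof.
move=> ij jk ik; have := uv_nonproportional ij jk ik; cbv zeta.
rewrite -(ltr_nat R) !(natrD, natrM) /heron_polar -subr_gt0.
by congr (0 < _); ring.
Qed.

(** For an [a] by [b] rectangle the weights of the three bits are [a (a + b)],
[b (a + b)] and [- a b]: (2, 2, -1) for the square, scaled by [t], and
(3, 6, -2) for the rectangle, scaled by [1 / t].  The two negative weights bear
on the common bit and add up; their sign is that of the fifth coordinate of
R^{4,1}. *)
Definition weight (R : realType) (t : R) (k : nat) : R :=
  nth 0 [:: 2 * t; 2 * t; 3 / t; 6 / t; t + 2 / t] k.

Lemma weight_gt0 (R : realType) (t : R) (k : 'I_5) : 0 < t -> 0 < weight t k.
Proof.
move=> t0; case: k => -[|[|[|[|[|//]]]]] /= _; rewrite /weight /=;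
by rewrite ?addr_gt0 ?mulr_gt0 ?invr_gt0.
Qed.

Definition label_point (R : realType) (i : 'I_6) : 'rV[R]_5 :=
  \row_k (label_bit k i)%:R.

Definition simplex_at (R : realType) (t : R) (i : 'I_6) : 'rV[R]_5 :=
  \row_k (Num.sqrt (weight t k) * (label_bit k i)%:R).

(** The identity [(a e1 + b e2)^2 = a (a + b) e1 + b (a + b) e2 - a b e3] for both
rectangles, checked on all values of the bits. *)
Lemma sqdist_simplex_at (R : realType) (t : R) (i j : 'I_6) : 0 < t ->
  sqdist 4 (simplex_at t i) (simplex_at t j)
  = t * (udist i j ^ 2)%:R + t^-1 * (vdist i j ^ 2)%:R.
Proof.
move=> t0; rewrite /sqdist dotpE.
have -> : \sum_(k < 5) msign R 4 k * ((simplex_at t i - simplex_at t j) 0 k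
                                      * (simplex_at t i - simplex_at t j) 0 k)
   = \sum_(k < 5) msign R 4 k
       * (weight t k * (label_bit k i (+) label_bit k j)%:R).
  apply: eq_bigr => k _; rewrite !mxE -mulrBr mulrACA -expr2.
  rewrite sqr_sqrtr ?ltW ?weight_gt0 //.
  by congr (_ * (_ * _)); case: (label_bit k i); case: (label_bit k j) => /=; ring.
rewrite !big_ord_recl big_ord0 /msign /weight /udist /vdist /label_bit /= /bump /=.
have t_neq0 : t != 0 by rewrite gt_eqF.
case: ((i %% 3 == 2)%N); case: ((j %% 3 == 2)%N); case: (2 < i)%N; case: (2 < j)%N;
case: ((i %% 3 != 0)%N); case: ((j %% 3 != 0)%N) => /=; by field.
Qed.

Lemma sqdist_simplex_at_gt0 (R : realType) (t : R) (i j : 'I_6) : 0 < t -> i != j ->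
  0 < sqdist 4 (simplex_at t i) (simplex_at t j).
Proof.
move=> t0 /dist_gt0; rewrite sqdist_simplex_at // addn_gt0 => /orP[] d_gt0.
  by rewrite ltr_wpDr ?mulr_ge0 ?invr_ge0 ?ler0n ?ltW // mulr_gt0 // ltr0n expn_gt0 d_gt0.
by rewrite ltr_wpDl ?mulr_ge0 ?ler0n ?ltW // mulr_gt0 ?invr_gt0 // ltr0n expn_gt0 d_gt0.
Qed.

(** Both extreme terms of [heron_lin2] vanish, so the areas do not depend on [t]. *)
Lemma simplex_at_heron (R : realType) (t : R) (i j k : 'I_6) : 0 < t ->
  heron (sqdist 4 (simplex_at t i) (simplex_at t j))
    (sqdist 4 (simplex_at t i) (simplex_at t k))
    (sqdist 4 (simplex_at t j) (simplex_at t k))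
  = 2 * heron_polar (udist i j ^ 2)%:R (udist i k ^ 2)%:R (udist j k ^ 2)%:R
        (vdist i j ^ 2)%:R (vdist i k ^ 2)%:R (vdist j k ^ 2)%:R.
Proof.
move=> t0; rewrite !sqdist_simplex_at // heron_lin2 ?gt_eqF //.
rewrite !heron_degenerate ?mulr0 ?add0r //.
  exact: vdist_degenerate.
exact: udist_degenerate.
Qed.

(** The vectors of the five bits and the constant vector 1 span R^6. *)
Lemma label_point_independent (R : realType) (c : 'I_6 -> R) :
  \sum_i c i = 0 ->
  (forall k : 'I_5, \sum_(i < 6) c i * (label_bit k i)%:R = 0) ->
  forall i, c i = 0.
Proof.
pose g n := c (inord n); have cg i : c i = g i by rewrite /g inord_val.
move=> c0 cb i; move: c0 (cb 0) (cb 1) (cb 2%:R) (cb 3%:R) (cb 4%:R).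
rewrite !big_ord_recr !big_ord0 /label_bit /= !cg /= !add0r => e0 e1 e2 e3 e4 e5.
by case_label i => /=; lra.
Qed.

Lemma simplex_at_independent (R : realType) (t : R) : 0 < t ->
  affinely_independent (simplex_at t).
Proof.
move=> t0 c c0 cQ; apply: label_point_independent => // k.
have /rowP/(_ k) := cQ; rewrite summxE mxE.
under eq_bigr do rewrite !mxE mulrCA.
rewrite -mulr_sumr => /eqP; rewrite mulf_eq0 sqrtr_eq0 leNgt weight_gt0 //=.
by move/eqP.
Qed.

Lemma det_edges_simplex_at (R : realType) (t : R) : 0 < t ->
  \det (edges (simplex_at t))
  = \det (edges (@label_point R)) * Num.sqrt (72 * (t + 2 / t)).
Proof.
move=> t0; have -> : edges (simplex_at t) =
    edges (@label_point R) *m diag_mx (\row_(k < 5) Num.sqrt (weight t k)).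
  by apply/matrixP => i j; rewrite mul_mx_diag !mxE; ring.
rewrite det_mulmx det_diag; congr (_ * _).
have -> : 72 * (t + 2 / t) = \prod_(k < 5) weight t k.
  rewrite !big_ord_recl big_ord0 /weight /= /bump /=; field.
  by rewrite gt_eqF.
rewrite !big_ord_recl !big_ord0 !mxE !mulr1.
by rewrite !sqrtrM ?ltW ?weight_gt0.
Qed.

(** The map [t + 2 / t] takes equal values at distinct [s] and [t] only if
[s t = 2], which [s, t >= 2] excludes. *)
Lemma kvolume_simplex_at_inj (R : realType) (s t : R) : 2 <= s -> 2 <= t ->
  kvolume 4 (simplex_at s) = kvolume 4 (simplex_at t) -> s = t.
Proof.
move=> s2 t2; have s0 : 0 < s by lra.
have t0 : 0 < t by lra.
have fact0 : (5`!)%:R != 0 :> R by rewrite pnatr_eq0 -lt0n fact_gt0.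
rewrite !kvolume_edges !det_edges_simplex_at // => /(divIf fact0).
have : \det (edges (simplex_at t)) != 0.
  exact: affinely_independent_det (simplex_at_independent t0).
rewrite det_edges_simplex_at // mulf_eq0 negb_or => /andP[det0 _].
rewrite !normrM => /(mulfI _); rewrite normr_eq0 => /(_ det0).
rewrite !ger0_norm ?sqrtr_ge0 // => /eqP; rewrite eqr_sqrt; last 2 first.
- by rewrite mulr_ge0 // addr_ge0 ?divr_ge0 // ltW.
- by rewrite mulr_ge0 // addr_ge0 ?divr_ge0 // ltW.
have neq72 : 72 != 0 :> R by rewrite pnatr_eq0.
move/eqP/(mulfI neq72) => st.
have s_neq0 : s != 0 by rewrite gt_eqF.
have t_neq0 : t != 0 by rewrite gt_eqF.
have : (s - t) * (s * t - 2) = 0.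
  have -> : (s - t) * (s * t - 2) = s * t * ((s + 2 / s) - (t + 2 / t)).
    by field; rewrite t_neq0.
  by rewrite st subrr mulr0.
move/eqP; rewrite mulf_eq0 => /orP[|/eqP]; first by rewrite subr_eq0 => /eqP.
by nra.
Qed.

Lemma weight_continuous (R : realType) (t : R) (k : 'I_5) : t != 0 ->
  weight x k @[x --> t] --> weight t k.
Proof.
move=> t0; have inv_t : x^-1 @[x --> t] --> t^-1 by apply: cvgV.
have lin c : c * x @[x --> t] --> c * t by apply: cvgM; [exact: cvg_cst|].
have inv c : c / x @[x --> t] --> c / t by apply: cvgM; [exact: cvg_cst|].
case: k => -[|[|[|[|[|//]]]]] /= _; rewrite /weight /=.
- exact: lin.
- exact: lin.
- exact: inv.
- exact: inv.
- by apply: cvgD; [exact: cvg_id|exact: inv].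
Qed.

Lemma simplex_at_continuous (R : realType) (t : R) (i : 'I_6) : t != 0 ->
  {for t, continuous (fun t => simplex_at t i)}.
Proof.
move=> t0.
have -> : (fun t : R => simplex_at t i) = fun t => \sum_(k < 5)
    (Num.sqrt (weight t k) * (label_bit k i)%:R) *: delta_mx 0 k.
  apply/funext => x; rewrite [LHS]row_sum_delta.
  by apply: eq_bigr => k _; rewrite mxE.
apply: cvg_big => [|k _]; first exact: add_continuous.
apply: cvgZ; last exact: cvg_cst.
apply: cvgM; last exact: cvg_cst.
apply: continuous_cvg; [exact: sqrt_continuous | exact: weight_continuous].
Qed.

(* The 2-faces of Q t are the simplices Q t \o f for f an injective choice of
   three vertex labels (each face occurs once for every ordering). *)
Theorem theorem1p5 (R : realType) :
  exists (p : nat) (I : set R) (Q : R -> 'I_6 -> 'rV[R]_5),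
    (2 <= p <= 5)%N /\
    (is_interval I /\ exists a b : R, [/\ I a, I b & a < b]) /\
    (forall i : 'I_6, {within I, continuous (fun t => Q t i)}) /\
    (forall t, I t -> affinely_independent (Q t)) /\
    (forall s t, I s -> I t -> s <> t -> ~ congruent p (Q s) (Q t)) /\
    (forall f : 'I_3 -> 'I_6, injective f ->
       forall s t, I s -> I t -> area p (Q s \o f) = area p (Q t \o f)) /\
    (forall t, I t -> forall f : 'I_3 -> 'I_6, injective f ->
       exists E : set 'rV[R]_5,
         euclidean_plane p E /\ convex_hull (Q t \o f) `<=` E) /\
    (exists s t, [/\ I s, I t & kvolume p (Q s) <> kvolume p (Q t)]).
Proof.
have ge2 (t : R) : t \in `[2, 3] -> 2 <= t by rewrite in_itv => /andP[].
have gt0 (t : R) : t \in `[2, 3] -> 0 < t by move=> /ge2; lra.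
have mem2 : (2 : R) \in `[2, 3] by rewrite in_itv /=; apply/andP; split; lra.
have mem3 : (3 : R) \in `[2, 3] by rewrite in_itv /=; apply/andP; split; lra.
exists 4%N, [set` `[2, 3]], (@simplex_at R); split=> //; split.
  split; first exact: interval_is_interval.
  by exists 2, 3; split=> //; lra.
split=> [i|].
  apply: continuous_in_subspaceT => t; rewrite inE => /gt0 t0.
  by apply: simplex_at_continuous; rewrite gt_eqF.
split=> [t /gt0|]; first exact: simplex_at_independent.
split=> [s t /ge2 s2 /ge2 t2 st /congruent_kvolume vol_st|].
  by apply: st; exact: kvolume_simplex_at_inj vol_st.
split=> [f finj s t /gt0 s0 /gt0 t0|].
  by rewrite !area_heron /= !simplex_at_heron.
split=> [t /gt0 t0 f finj|].
  have ne i j : i != j -> f i != f j by rewrite (inj_eq finj).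
  apply: euclidean_triangle => /=.
    exact/sqdist_simplex_at_gt0/ne.
  by rewrite simplex_at_heron // mulr_gt0 // uv_polar_gt0 // ne.
by exists 2, 3; split=> // /kvolume_simplex_at_inj; lra.
Qed.
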